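(* Let $F$ be a field, $\kappa$ a regular uncountable cardinal, $i\in B(\kappa)$, and let $W\subseteq\kappa$ be such that $0\in W$ and $\overline{\kappa\setminus W}=i$. Let $L$ be the $F$-linear space and $R\subseteq \mathrm{End}_F(L)$ the $F$-algebra constructed from $F,\kappa,W$ in the context (so $L$ is a right $R$-module). Let $$S=\left\{\begin{pmatrix} f & l\\ 0 & r\end{pmatrix}\ \middle|\ f\in F,\ l\in L,\ r\in R\right\},\qquad I=\left\{\begin{pmatrix} 0 & l\\ 0 & 0\end{pmatrix}\ \middle|\ l\in L\right\},$$ with matrix addition and multiplication. Then $S$ is an $F$-algebra and $I$ is a two-sided ideal of $S$. Let $A$ be the interval in the lattice of all two-sided ideals of $S$ consisting of all two-sided ideals contained in $I$. Then $A$ is a strongly dense lattice of dimension $\kappa$ and $\Gamma(A)=i$.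
   Context: For a regular uncountable cardinal $\kappa$, $B(\kappa)$ is the Boolean algebra of subsets of $\kappa$ modulo the club filter: for $E\subseteq\kappa$, $\overline{E}$ is the class of all $D\subseteq\kappa$ with $D\cap C=E\cap C$ for some closed unbounded $C\subseteq\kappa$. Lattices. Let $A$ be a bounded modular lattice with least element $0$ and greatest element $1$. A c.d.c. of length $\kappa$ in $A$ is a sequence $\mathcal U=(a_\alpha\mid\alpha<\kappa)$ of non-zero elements of $A$ that is continuous ($a_0=1$, and $a_\alpha=\bigwedge_{\beta<\alpha}a_\beta$ for limit $\alpha$), strictly decreasing ($a_{\alpha+1}<a_\alpha$), and cofinal (each non-zero element of $A$ is $\ge$ some $a_\alpha$). $A$ is strongly dense if it has a c.d.c.; its dimension is the least length of a c.d.c. For $0\neq b<a\le1$, $a$ is complemented over $b$ if there is $c\in A$ with $a\wedge c=b$ and $a\vee c=1$. If $A$ is strongly dense of dimension $\kappa$ (regular uncountable), and $\mathcal U$ is a c.d.c. of length $\kappa$, then $E_{\mathcal U}=\{\alpha<\kappa\mid\exists\beta:\alpha<\beta<\kappa$ and $a_\alpha$ is not complemented over $a_\beta\}$, and $\Gamma(A)=\overline{E_{\mathcal U}}\in B(\kappa)$, which does not depend on the choice of $\mathcal U$ (known fact). Construction of $L$ and $R$ from a field $F$, a regular uncountable cardinal $\kappa$ and $W\subseteq\kappa$ with $0\in W$. For $\alpha<\kappa$ let $Y_\alpha$ be the set of all finite sequences $\langle(\alpha_i,\beta_i);i\le n\rangle$, $n<\omega$, with $\alpha_n=\alpha$, $\alpha_i<\beta_i<\kappa$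 for all $i\le n$, $\alpha_i\in W$ for all $0<i\le n$, and $\alpha_i<\alpha_{i+1}$ for all $i<n$. Put $Y=\bigcup_{\alpha<\kappa}Y_\alpha$, $Y_{<\alpha}=\bigcup_{\beta<\alpha}Y_\beta$, $Y_{\ge\alpha}=\bigcup_{\alpha\le\beta<\kappa}Y_\beta$. For $y=\langle(\alpha_i,\beta_i);i\le n\rangle\in Y$ put $\mathrm{amax}(y)=\alpha_n$, $\mathrm{bmax}(y)=\max_{i\le n}\beta_i$. Let $L$ be the $F$-linear space with basis $\{x_\eta\mid\eta\in Y\}$. The symbol $\frown$ denotes appending a pair to a sequence. For $\nu,\rho\in Y$ with $\mathrm{amax}(\rho)\ge\mathrm{bmax}(\nu)$ define $T=T_{\nu\rho}\in\mathrm{End}_F(L)$ (acting on the right) on the basis by induction on the length of $\eta$: - $x_\eta T=0$ if $\nu$ is not an initial segment of $\eta$; - $x_\nu T=x_\rho$; - if $\eta=\eta'\frown(\alpha,\beta)$ with $\nu$ an initial segment of $\eta'$, and $x_{\eta'}T=x_{\rho'}$, then $x_\eta T=x_{\rho'}$ if $\rho'\in Y_{\ge\alpha}$, and $x_\eta T=x_{\rho'\frown(\alpha,\beta)}$ if $\rho'\in Y_{<\alpha}$. $R$ is the unital $F$-subalgebra of $\mathrm{End}_F(L)$ generated by all $T_{\nu\rho}$ with $\nu,\rho\in Y$, $\mathrm{amax}(\rho)\ge\mathrm{bmax}(\nu)$; $L$ is a right $R$-module. *)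

(* Defs.v *)
From HB Require Import structures.
From mathcomp Require Import all_boot all_order all_algebra.
From mathcomp Require wochoice.
From mathcomp Require Import all_classical.
From mathcomp Require Import finmap monalg.

Set Implicit Arguments.
Unset Strict Implicit.
Unset Printing Implicit Defensive.

Import Order.TTheory GRing.Theory.

Local Open Scope classical_set_scope.
Local Open Scope order_scope.

(* An ordinal is represented by a well-ordered [K : orderType d], the elements
   of [K] being the smaller ordinals. *)

Section Ordinals.
Context {d : Order.disp_t} (K : orderType d).

Definition well_ordered : Prop := wochoice.well_order (<=%O : rel K).

Definition is_zero (a : K) : Prop := forall b, a <= b.

(* [is_succ a b] : b = a + 1 *)
Definition is_succ (a b : K) : Prop := a < b /\ forall c, a < c -> b <= c.

Definition is_limit (a : K) : Prop :=
  ~ is_zero a /\ forall b, ~ is_succ b a.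

(* The second clause says that the ordinal K is a cardinal (it is equinumerous
   to none of its proper initial segments), the third one that its cofinality
   is K. *)
Definition regular_uncountable_cardinal : Prop :=
  [/\ well_ordered,
      forall a : K, ~ ([set: K] #<= [set b | b < a])%card,
      forall (a : K) (f : K -> K), exists c, forall b, b < a -> f b < c
    & ~ countable [set: K]].

Definition unbounded (C : set K) : Prop := forall a, exists2 c, C c & a < c.

Definition closed_subset (C : set K) : Prop :=
  forall a, is_limit a ->
    (forall b, b < a -> exists2 c, C c & b < c < a) -> C a.

Definition club (C : set K) : Prop := closed_subset C /\ unbounded C.

(* the class of E modulo the club filter *)
Definition club_class (E : set K) : set (set K) :=
  [set D | exists2 C, club C & D `&` C = E `&` C].

(* the elements of B(kappa), for kappa = K *)
Definition club_algebra : set (set (set K)) := range club_class.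

End Ordinals.

(* order type of K <= order type of J : K is isomorphic to an initial segment *)
Definition ordinal_le d (K : orderType d) d' (J : orderType d') : Prop :=
  exists2 f : K -> J,
    {homo f : x y / x < y} & forall x y, y <= f x -> exists z, f z = y.

Definition modular d (A : latticeType d) : Prop :=
  forall x y z : A, x <= z ->
    Order.join x (Order.meet y z) = Order.meet (Order.join x y) z.

Section Lattices.
Context {dA : Order.disp_t} (A : tbLatticeType dA).

Definition is_cdc d (J : orderType d) (a : J -> A) : Prop :=
  [/\ forall i, a i != \bot,
      (forall i, is_zero i -> a i = \top) /\
      (forall i, is_limit i -> infimums (a @` [set j | j < i]) (a i)),
      forall i j, is_succ i j -> a j < a i
    & forall x, x != \bot -> exists i, a i <= x].

(* Lengths of c.d.c.'s are arbitrary ordinals. *)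
Definition strongly_dense : Prop :=
  exists d (J : orderType d), well_ordered J /\ exists a : J -> A, is_cdc a.

Definition has_dimension d (K : orderType d) : Prop :=
  (exists a : K -> A, is_cdc a) /\
  forall d' (J : orderType d'), well_ordered J ->
    (exists a : J -> A, is_cdc a) -> ordinal_le K J.

Definition complemented_over (a b : A) : Prop :=
  exists c : A, Order.meet a c = b /\ Order.join a c = \top.

Definition cdc_E d (K : orderType d) (a : K -> A) : set K :=
  [set i | exists2 j, i < j & ~ complemented_over (a i) (a j)].

(* Gamma(A) = i for A of dimension K : every c.d.c. of length K has its set E
   in the class i, and there is at least one. *)
Definition is_Gamma d (K : orderType d) (i : set (set K)) : Prop :=
  (exists a : K -> A, is_cdc a) /\
  forall a : K -> A, is_cdc a -> club_class (cdc_E a) = i.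

End Lattices.

Section Ideals.
Local Open Scope ring_scope.

Definition two_sided_ideal (S : pzRingType) (I : set S) : Prop :=
  [/\ I 0, forall x y, I x -> I y -> I (x - y),
      forall a x, I x -> I (a * x) & forall x a, I x -> I (x * a)].

Record ideal (S : pzRingType) := Ideal {
  ideal_set : set S;
  ideal_setP : two_sided_ideal ideal_set }.

Variable S : pzRingType.
Implicit Types I J : ideal S.

Lemma ideal_inj I J : ideal_set I = ideal_set J -> I = J.
Proof. by case: I J => [I hI] [J hJ] /= e; subst J; congr Ideal. Qed.

Lemma ideal0 I : ideal_set I 0. Proof. by case: (ideal_setP I). Qed.
Lemma idealB I x y : ideal_set I x -> ideal_set I y -> ideal_set I (x - y).
Proof. by case: (ideal_setP I) => _ h _ _; exact: h. Qed.
Lemma idealN I x : ideal_set I x -> ideal_set I (- x).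
Proof. by rewrite -sub0r; apply: idealB; apply: ideal0. Qed.
Lemma idealD I x y : ideal_set I x -> ideal_set I y -> ideal_set I (x + y).
Proof. by move=> hx hy; rewrite -[y]opprK; apply: idealB => //; apply: idealN. Qed.
Lemma idealMl I a x : ideal_set I x -> ideal_set I (a * x).
Proof. by case: (ideal_setP I) => _ _ h _; exact: h. Qed.
Lemma idealMr I x a : ideal_set I x -> ideal_set I (x * a).
Proof. by case: (ideal_setP I) => _ _ _ h; exact: h. Qed.

Lemma ideal_meetP I J : two_sided_ideal (ideal_set I `&` ideal_set J).
Proof.
split; first by split; apply: ideal0.
- by move=> x y [? ?] [? ?]; split; apply: idealB.
- by move=> a x [? ?]; split; apply: idealMl.
- by move=> x a [? ?]; split; apply: idealMr.
Qed.

Lemma ideal_joinP I J :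
  two_sided_ideal [set z | exists x y, [/\ ideal_set I x, ideal_set J y & z = x + y]].
Proof.
split=> /=.
- by exists 0, 0; split; [exact: ideal0..|rewrite addr0].
- move=> _ _ [x1 [y1 [? ? ->]]] [x2 [y2 [? ? ->]]].
  by exists (x1 - x2), (y1 - y2); split; [exact: idealB..|rewrite opprD addrACA].
- move=> a _ [x [y [? ? ->]]].
  by exists (a * x), (a * y); split; [exact: idealMl..|rewrite mulrDr].
- move=> _ a [x [y [? ? ->]]].
  by exists (x * a), (y * a); split; [exact: idealMr..|rewrite mulrDl].
Qed.

Lemma ideal_botP : two_sided_ideal [set 0 : S].
Proof.
split=> //=; first by move=> x y -> ->; rewrite subr0.
- by move=> a x ->; rewrite mulr0.
- by move=> x a ->; rewrite mul0r.
Qed.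

Lemma ideal_topP : two_sided_ideal [set: S]. Proof. by []. Qed.

Definition ideal_le I J : bool := `[< ideal_set I `<=` ideal_set J >].
Definition ideal_meet I J : ideal S := Ideal (ideal_meetP I J).
Definition ideal_join I J : ideal S := Ideal (ideal_joinP I J).

Lemma ideal_le_refl : reflexive ideal_le.
Proof. by move=> I; apply/asboolP. Qed.
Lemma ideal_le_anti : antisymmetric ideal_le.
Proof.
by move=> I J /andP[/asboolP h1 /asboolP h2]; apply/ideal_inj/seteqP; split.
Qed.
Lemma ideal_le_trans : transitive ideal_le.
Proof.
by move=> J I K /asboolP h1 /asboolP h2; apply/asboolP; apply: subset_trans h2.
Qed.

End Ideals.

Fact ideal_display : Order.disp_t. Proof. exact: Order.Disp tt tt. Qed.

HB.instance Definition _ (S : pzRingType) := gen_eqMixin (ideal S).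
HB.instance Definition _ (S : pzRingType) := gen_choiceMixin (ideal S).
HB.instance Definition _ (S : pzRingType) :=
  Order.Le_isPOrder.Build ideal_display (ideal S)
    (@ideal_le_refl S) (@ideal_le_anti S) (@ideal_le_trans S).

Section IdealLattice.
Variable S : pzRingType.
Implicit Types I J : ideal S.

Lemma ideal_leP I J : reflect (ideal_set I `<=` ideal_set J) (I <= J).
Proof. exact: asboolP. Qed.

Lemma ideal_lexI I J L : (I <= ideal_meet J L) = (I <= J) && (I <= L).
Proof.
apply/ideal_leP/andP => [h|[/ideal_leP h1 /ideal_leP h2]].
  by split; apply/ideal_leP => x /h [].
by move=> x hx; split; [apply: h1|apply: h2].
Qed.

Lemma ideal_leUx I J L : (ideal_join I J <= L) = (I <= L) && (J <= L).
Proof.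
apply/ideal_leP/andP => [h|[/ideal_leP h1 /ideal_leP h2]].
  split; apply/ideal_leP => x hx; apply: h.
    by exists x, 0%R; split=> //; [exact: ideal0|rewrite addr0].
  by exists 0%R, x; split=> //; [exact: ideal0|rewrite add0r].
by move=> _ [x [y [hx hy ->]]]; apply: idealD; [apply: h1|apply: h2].
Qed.

Lemma ideal_le0x I : Ideal (ideal_botP S) <= I.
Proof. by apply/ideal_leP => _ ->; exact: ideal0. Qed.
Lemma ideal_lex1 I : I <= Ideal (@ideal_topP S).
Proof. exact/ideal_leP. Qed.

HB.instance Definition _ :=
  Order.POrder_MeetJoin_isLattice.Build ideal_display (ideal S)
    ideal_lexI ideal_leUx.
HB.instance Definition _ :=
  Order.hasBottom.Build ideal_display (ideal S) ideal_le0x.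
HB.instance Definition _ :=
  Order.hasTop.Build ideal_display (ideal S) ideal_lex1.

End IdealLattice.

Section Downset.
Context {d : Order.disp_t} (A : tbLatticeType d) (t : A).

(* the interval [\bot, t] *)
Record downset := Downset { downset_val :> A; _ : downset_val <= t }.

HB.instance Definition _ := [isSub of downset for downset_val].
HB.instance Definition _ := [Choice of downset by <:].

Lemma downset_closedI : Order.ClosedPredicates.meet_closed [pred x | x <= t].
Proof. by move=> x y; rewrite !inE => hx _; apply: leIx2; rewrite hx. Qed.
Lemma downset_closedU : Order.ClosedPredicates.join_closed [pred x | x <= t].
Proof. by move=> x y; rewrite !inE leUx => -> ->. Qed.

HB.instance Definition _ :=
  Order.SubChoice_isSubLattice.Build d A [pred x | x <= t] d downset
    downset_closedI downset_closedU.

Lemma downset_le0x (x : downset) : Downset (le0x t) <= x.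
Proof. exact: (le0x (val x)). Qed.
Lemma downset_lex1 (x : downset) : x <= Downset (lexx t).
Proof. exact: (valP x). Qed.

HB.instance Definition _ := Order.hasBottom.Build d downset downset_le0x.
HB.instance Definition _ := Order.hasTop.Build d downset downset_lex1.

End Downset.

Local Open Scope ring_scope.

Section RightEndomorphisms.
Variables (F : fieldType) (V : lmodType F).

(* A copy of {linear V -> V}, so that the product below is attached to it. *)
Definition rend : Type := {linear V -> V}.

Definition rapp (v : V) (f : rend) : V := (f : {linear V -> V}) v.

Lemma rendP (f g : rend) : (forall v, rapp v f = rapp v g) -> f = g.
Proof.
case: f g => f [[m1] [m2]] [g [[n1] [n2]]] fg.
have e : f = g by apply/funext.
by subst g; rewrite (Prop_irrelevance m1 n1) (Prop_irrelevance m2 n2).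
Qed.

HB.instance Definition _ := gen_eqMixin rend.
HB.instance Definition _ := gen_choiceMixin rend.

Definition rend0 : rend := (\0 : V -> V).
Definition rend1 : rend := (idfun : V -> V).
Definition rendN (f : rend) : rend := \- (f : {linear V -> V}).
Definition rendD (f g : rend) : rend :=
  (f : {linear V -> V}) \+ (g : {linear V -> V}).
Definition rendZ (c : F) (f : rend) : rend := c \*: (f : {linear V -> V}).
(* v (f g) = (v f) g *)
Definition rendM (f g : rend) : rend :=
  (g : {linear V -> V}) \o (f : {linear V -> V}).


Lemma rend_addA : associative rendD.
Proof. by move=> f g h; apply: rendP => v; apply: addrA. Qed.
Lemma rend_addC : commutative rendD.
Proof. by move=> f g; apply: rendP => v; apply: addrC. Qed.
Lemma rend_add0 : left_id rend0 rendD.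
Proof. by move=> f; apply: rendP => v; apply: add0r. Qed.
Lemma rend_addN : left_inverse rend0 rendN rendD.
Proof. by move=> f; apply: rendP => v; apply: addNr. Qed.

HB.instance Definition _ :=
  GRing.isZmodule.Build rend rend_addA rend_addC rend_add0 rend_addN.

Lemma rend_mulA : associative rendM.
Proof. by move=> f g h; apply: rendP. Qed.
Lemma rend_mul1 : left_id rend1 rendM.
Proof. by move=> f; apply: rendP. Qed.
Lemma rend_mulr1 : right_id rend1 rendM.
Proof. by move=> f; apply: rendP. Qed.
Lemma rend_mulDl : left_distributive rendM +%R.
Proof. by move=> f g h; apply: rendP => v; apply: (raddfD (h : {linear V -> V})). Qed.
Lemma rend_mulDr : right_distributive rendM +%R.
Proof. by move=> f g h; apply: rendP. Qed.

HB.instance Definition _ := GRing.Zmodule_isPzRing.Build rend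
  rend_mulA rend_mul1 rend_mulr1 rend_mulDl rend_mulDr.

Lemma rend_scaleA a b f : rendZ a (rendZ b f) = rendZ (a * b) f.
Proof. by apply: rendP => v; apply: scalerA. Qed.
Lemma rend_scale1 : left_id 1 rendZ.
Proof. by move=> f; apply: rendP => v; apply: scale1r. Qed.
Lemma rend_scaleDr : right_distributive rendZ +%R.
Proof. by move=> a f g; apply: rendP => v; apply: scalerDr. Qed.
Lemma rend_scaleDl f : {morph rendZ^~ f : a b / a + b}.
Proof. by move=> a b; apply: rendP => v; apply: scalerDl. Qed.

HB.instance Definition _ := GRing.Zmodule_isLmodule.Build F rend
  rend_scaleA rend_scale1 rend_scaleDr rend_scaleDl.

Lemma rappM v (f g : rend) : rapp v (f * g) = rapp (rapp v f) g.
Proof. by []. Qed.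
Lemma rapp1 v : rapp v 1 = v. Proof. by []. Qed.
Lemma rappD v (f g : rend) : rapp v (f + g) = rapp v f + rapp v g.
Proof. by []. Qed.
Lemma rapp0 v : rapp v 0 = 0. Proof. by []. Qed.
Lemma rappZ c v (f : rend) : rapp v (c *: f) = c *: rapp v f.
Proof. by []. Qed.
Lemma rapp_linear (f : rend) : linear (rapp^~ f).
Proof. exact: (linearP (f : {linear V -> V})). Qed.
Lemma rapp_addl (f : rend) u v : rapp (u + v) f = rapp u f + rapp v f.
Proof. exact: (raddfD (f : {linear V -> V})). Qed.
Lemma rapp_scalel (f : rend) c v : rapp (c *: v) f = c *: rapp v f.
Proof. exact: (linearZ_LR (f : {linear V -> V})). Qed.
Lemma rapp0l (f : rend) : rapp 0 f = 0.
Proof. exact: (raddf0 (f : {linear V -> V})). Qed.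

(* GRing.subalg_closed requires 1 != 0, which fails in rend when V = 0. *)
Definition unital_subalgebra (P : set rend) : Prop :=
  [/\ P 1, forall c f g, P f -> P g -> P (c *: f + g)
    & forall f g, P f -> P g -> P (f * g)].

Definition generated_subalgebra (G : set rend) : set rend :=
  smallest unital_subalgebra G.

Lemma generated_subalgebraP G : unital_subalgebra (generated_subalgebra G).
Proof.
split; first by move=> P [[]].
- by move=> c f g hf hg P hP; case: (hP) => [[_ h _] _]; apply: h; [apply: hf|apply: hg].
- by move=> f g hf hg P hP; case: (hP) => [[_ _ h] _]; apply: h; [apply: hf|apply: hg].
Qed.

End RightEndomorphisms.

Arguments rapp : simpl never.

Section TriangularMatrices.
Variables (F : fieldType) (V : lmodType F).

(* the matrix (f l; 0 r) with r in End_F(V) *)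
Record trimx := Trimx { tri_f : F; tri_l : V; tri_r : rend V }.

Definition trimx_tuple (m : trimx) := (tri_f m, tri_l m, tri_r m).
Definition tuple_trimx (t : F * V * rend V) := Trimx t.1.1 t.1.2 t.2.
Lemma trimx_tupleK : cancel trimx_tuple tuple_trimx. Proof. by case. Qed.

HB.instance Definition _ := Choice.copy trimx (can_type trimx_tupleK).

Implicit Types m n p : trimx.

Definition trimx0 := Trimx 0 0 0.
Definition trimx1 := Trimx 1 0 1.
Definition trimxN m := Trimx (- tri_f m) (- tri_l m) (- tri_r m).
Definition trimxD m n :=
  Trimx (tri_f m + tri_f n) (tri_l m + tri_l n) (tri_r m + tri_r n).
Definition trimxZ (c : F) m := Trimx (c * tri_f m) (c *: tri_l m) (c *: tri_r m).
Definition trimxM m n :=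
  Trimx (tri_f m * tri_f n)
        (tri_f m *: tri_l n + rapp (tri_l m) (tri_r n))
        (tri_r m * tri_r n).

Lemma trimx_addA : associative trimxD.
Proof. by move=> m n p; rewrite /trimxD /= !addrA. Qed.
Lemma trimx_addC : commutative trimxD.
Proof. by move=> m n; congr Trimx; apply: addrC. Qed.
Lemma trimx_add0 : left_id trimx0 trimxD.
Proof. by case=> f l r; rewrite /trimxD /= !add0r. Qed.
Lemma trimx_addN : left_inverse trimx0 trimxN trimxD.
Proof. by case=> f l r; rewrite /trimxD /= !addNr. Qed.

HB.instance Definition _ :=
  GRing.isZmodule.Build trimx trimx_addA trimx_addC trimx_add0 trimx_addN.

Lemma trimx_mulA : associative trimxM.
Proof.
move=> m n p; congr Trimx => /=; try exact: mulrA.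
by rewrite scalerDr scalerA rapp_addl rapp_scalel rappM addrA.
Qed.
Lemma trimx_mul1 : left_id trimx1 trimxM.
Proof. by case=> f l r; rewrite /trimxM /= !mul1r scale1r rapp0l addr0. Qed.
Lemma trimx_mulr1 : right_id trimx1 trimxM.
Proof. by case=> f l r; rewrite /trimxM /= !mulr1 scaler0 rapp1 add0r. Qed.
Lemma trimx_mulDl : left_distributive trimxM +%R.
Proof.
move=> m n p; congr Trimx => /=; try exact: mulrDl.
by rewrite scalerDl rapp_addl addrACA.
Qed.
Lemma trimx_mulDr : right_distributive trimxM +%R.
Proof.
move=> m n p; congr Trimx => /=; try exact: mulrDr.
by rewrite scalerDr rappD addrACA.
Qed.
Lemma trimx_1neq0 : trimx1 != 0.
Proof. by apply/eqP => /(congr1 tri_f) /eqP; rewrite oner_eq0. Qed.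

HB.instance Definition _ := GRing.Zmodule_isNzRing.Build trimx
  trimx_mulA trimx_mul1 trimx_mulr1 trimx_mulDl trimx_mulDr trimx_1neq0.

Lemma trimx_scaleA a b m : trimxZ a (trimxZ b m) = trimxZ (a * b) m.
Proof. by rewrite /trimxZ /= mulrA !scalerA. Qed.
Lemma trimx_scale1 : left_id 1 trimxZ.
Proof. by case=> f l r; rewrite /trimxZ /= mul1r !scale1r. Qed.
Lemma trimx_scaleDr : right_distributive trimxZ +%R.
Proof. by move=> a m n; rewrite /trimxZ /= mulrDr !scalerDr. Qed.
Lemma trimx_scaleDl m : {morph trimxZ^~ m : a b / a + b}.
Proof. by move=> a b; rewrite /trimxZ /= mulrDl !scalerDl. Qed.

HB.instance Definition _ := GRing.Zmodule_isLmodule.Build F trimx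
  trimx_scaleA trimx_scale1 trimx_scaleDr trimx_scaleDl.

Lemma trimx_scaleAl (a : F) (m n : trimx) : a *: (m * n) = (a *: m) * n.
Proof.
congr Trimx => /=; first exact: mulrA.
  by rewrite scalerDr scalerA rapp_scalel.
by apply: rendP => v; rewrite !(rappM, rappZ) rapp_scalel.
Qed.
Lemma trimx_scaleAr (a : F) (m n : trimx) : a *: (m * n) = m * (a *: n).
Proof.
congr Trimx => /=; first exact: mulrCA.
  by rewrite scalerDr !scalerA mulrC rappZ.
by apply: rendP => v; rewrite !(rappM, rappZ).
Qed.

HB.instance Definition _ :=
  GRing.Lmodule_isLalgebra.Build F trimx trimx_scaleAl.
HB.instance Definition _ :=
  GRing.Lalgebra_isAlgebra.Build F trimx trimx_scaleAr.

End TriangularMatrices.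

Section Construction.
Context (F : fieldType) {d : Order.disp_t} {K : orderType d} (W : set K).
Local Open Scope order_scope.

(* nonempty sequences of pairs: first entry, remaining entries *)
Definition ne_seq : Type := ((K * K) * seq (K * K))%type.

Implicit Types s t : ne_seq.

Definition amax s : K := (last s.1 s.2).1.
Definition bmax s : K := foldr Order.max s.1.2 [seq p.2 | p <- s.2].
Definition snoc s (p : K * K) : ne_seq := (s.1, rcons s.2 p).
Definition initial_segment s t : bool := (s.1 == t.1) && prefix s.2 t.2.

(* W constrains all entries but the first one. *)
Definition in_Y s : bool :=
  [&& all (fun p => p.1 < p.2) (s.1 :: s.2),
      all (fun p => p.1 \in W) s.2
    & path (fun p q => p.1 < q.1) s.1 s.2].

Record Y := MkY { Yval :> ne_seq; _ : in_Y Yval }.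

HB.instance Definition _ := [isSub of Y for Yval].
HB.instance Definition _ := [Choice of Y by <:].

Implicit Types nu rho eta : Y.

Lemma snoc_in_Y rho (p : K * K) :
  in_Y (snoc rho p) = [&& p.1 < p.2, p.1 \in W & amax rho < p.1].
Proof.
case: rho => -[r0 r] /= /and3P[/= /andP[h1 h2] h3 h4].
by rewrite /in_Y /= !all_rcons rcons_path h1 h2 h3 h4 /= !andbT.
Qed.

(* From x_(eta') T = x_rho' to x_eta T, for eta = eta' ^ p. As eta is in Y, the
   sequence rho' ^ p is in Y whenever amax rho' < p.1 (snoc_in_Y), so that the
   default value rho' of insubd is never used. *)
Definition Tstep rho (p : K * K) : Y :=
  if amax rho < p.1 then insubd rho (snoc rho p) else rho.

(* x_eta T_(nu, rho) : [Some r] stands for x_r and [None] for 0 *)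
Definition Tbasis nu rho eta : option Y :=
  if initial_segment nu eta
  then Some (foldl Tstep rho (drop (size (Yval nu).2) (Yval eta).2))
  else None.

Lemma Tbasis_not_initial nu rho eta :
  ~~ initial_segment nu eta -> Tbasis nu rho eta = None.
Proof. by rewrite /Tbasis => /negbTE ->. Qed.

Lemma Tbasis_self nu rho : Tbasis nu rho nu = Some rho.
Proof. by rewrite /Tbasis /initial_segment eqxx prefix_refl /= drop_size. Qed.

Lemma Tbasis_snoc nu rho eta' eta (p : K * K) rho' :
  Yval eta = snoc eta' p -> initial_segment nu eta' ->
  Tbasis nu rho eta' = Some rho' ->
  exists2 rho'', Tbasis nu rho eta = Some rho'' &
    Yval rho'' = if amax rho' < p.1 then snoc rho' p else Yval rho'.
Proof.
rewrite /Tbasis => eE hi; rewrite hi => -[hr].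
have : in_Y (Yval eta) := valP eta.
rewrite eE snoc_in_Y => /and3P[p1 p2 _].
move: hi; rewrite /initial_segment => /andP[/eqP e1 hp].
rewrite /= e1 eqxx /= (prefix_trans hp (prefix_rcons _ _)).
have hs : (size (Yval nu).2 <= size (Yval eta').2)%N by apply: size_prefix.
rewrite drop_rcons // foldl_rcons hr; eexists; first by [].
rewrite /Tstep; case: ifP => // ha.
by rewrite val_insubd snoc_in_Y p1 p2 ha.
Qed.

Local Open Scope ring_scope.

(* {malg F[Y]} is used only as the free F-module with basis Y. *)
Definition L : lmodType F := {malg F[Y]}.

Definition x_ (eta : Y) : L := << eta >>.

Definition Tfun nu rho (v : L) : L :=
  \sum_(eta <- msupp v) v@_eta *: oapp x_ 0 (Tbasis nu rho eta).

Lemma TfunEw nu rho (v : L) (D : {fset Y}) : (msupp v `<=` D)%fset ->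
  Tfun nu rho v = \sum_(eta <- D) v@_eta *: oapp x_ 0 (Tbasis nu rho eta).
Proof.
move=> sD; apply: big_fset_incl => // eta _ h.
by rewrite mcoeff_outdom // scale0r.
Qed.

Lemma Tfun_linear nu rho : linear (Tfun nu rho).
Proof.
move=> c u v.
pose D := (msupp u `|` msupp v `|` msupp (c *: u + v))%fset.
have sw : (msupp (c *: u + v) `<=` D)%fset by apply: fsubsetUr.
have su : (msupp u `<=` D)%fset.
  by apply: fsubset_trans (fsubsetUl _ _); apply: fsubsetUl.
have sv : (msupp v `<=` D)%fset.
  by apply: fsubset_trans (fsubsetUl _ _); apply: fsubsetUr.
rewrite (TfunEw nu rho sw) (TfunEw nu rho su) (TfunEw nu rho sv).
rewrite scaler_sumr -big_split /=; apply: eq_bigr => eta _.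
by rewrite mcoeffD mcoeffZ scalerDl scalerA.
Qed.

HB.instance Definition _ nu rho :=
  GRing.isLinear.Build F L L *:%R (Tfun nu rho) (@Tfun_linear nu rho).

Definition T nu rho : rend L := Tfun nu rho : {linear L -> L}.

Lemma T_basis nu rho eta : rapp (x_ eta) (T nu rho) = oapp x_ 0 (Tbasis nu rho eta).
Proof.
rewrite /rapp /T /= (@TfunEw _ _ _ [fset eta]%fset) ?msuppU_le //.
by rewrite big_seq_fset1 mcoeffUU scale1r.
Qed.

Definition alg_R : set (rend L) :=
  generated_subalgebra [set t | exists nu rho,
    (bmax nu <= amax rho)%O /\ t = T nu rho].

Definition in_S (m : trimx L) : bool := tri_r m \in alg_R.

Record alg_S := MkS { Sval :> trimx L; _ : in_S Sval }.

HB.instance Definition _ := [isSub of alg_S for Sval].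
HB.instance Definition _ := [Choice of alg_S by <:].

Lemma in_S_closed : GRing.subalg_closed in_S.
Proof.
have [R1 RZ RM] := generated_subalgebraP [set t | exists nu rho,
    (bmax nu <= amax rho)%O /\ t = T nu rho].
split; first exact: mem_set.
- by move=> c m n hm hn; exact: (mem_set (RZ _ _ _ (set_mem hm) (set_mem hn))).
- by move=> m n hm hn; exact: (mem_set (RM _ _ (set_mem hm) (set_mem hn))).
Qed.

HB.instance Definition _ := GRing.isSubalgClosed.Build F (trimx L) in_S
  (GRing.subalg_closed_semi in_S_closed).
HB.instance Definition _ := [SubChoice_isSubAlgebra of alg_S by <:].

Lemma SvalD (m n : alg_S) : Sval (m + n) = Sval m + Sval n.
Proof. exact: (raddfD (val : alg_S -> trimx L)). Qed.
Lemma SvalB (m n : alg_S) : Sval (m - n) = Sval m - Sval n.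
Proof. exact: (raddfB (val : alg_S -> trimx L)). Qed.
Lemma SvalM (m n : alg_S) : Sval (m * n) = Sval m * Sval n.
Proof. exact: (rmorphM (val : alg_S -> trimx L)). Qed.
Lemma SvalZ (c : F) (m : alg_S) : Sval (c *: m) = c *: Sval m.
Proof. exact: (linearZ_LR (val : alg_S -> trimx L)). Qed.
Lemma Sval1 : Sval 1 = 1.
Proof. exact: (rmorph1 (val : alg_S -> trimx L)). Qed.

Definition S_ideal_I : set alg_S :=
  [set m | exists l : L, Sval m = Trimx 0 l 0].

Lemma S_ideal_IP : two_sided_ideal S_ideal_I.
Proof.
split; first by exists 0.
- move=> m n [l hl] [k hk]; exists (l - k).
  by rewrite SvalB hl hk; congr Trimx; apply: subr0.
- move=> m n [l hl]; exists (tri_f (Sval m) *: l).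
  rewrite SvalM hl; congr Trimx => /=; rewrite ?mulr0 ?rapp0 ?addr0 //.
- move=> n m [l hl]; exists (rapp l (tri_r (Sval m))).
  by rewrite SvalM hl; congr Trimx => /=; rewrite ?mul0r ?scale0r ?add0r.
Qed.

Definition lattice_A := downset (Ideal S_ideal_IP).

End Construction.

Arguments x_ F {d K W} eta.
Arguments T F {d K W} nu rho.
Arguments alg_R F {d K} W.
Arguments in_S F {d K} W m.
Arguments alg_S F {d K} W.
Arguments S_ideal_I F {d K} W.
Arguments lattice_A F {d K} W.

(* Main.v *)
Require Import Defs.
From HB Require Import structures.
From mathcomp Require Import all_boot all_order all_algebra.
From mathcomp Require Import all_classical.
From mathcomp Require Import finmap monalg.

Set Implicit Arguments.
Unset Strict Implicit.
Unset Printing Implicit Defensive.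

Import Order.TTheory GRing.Theory.

Local Open Scope order_scope.
Local Open Scope classical_set_scope.

(* Two-sided ideals of S inside I are the R-submodules of L, and the tails
   L_{>=a} = span {x_eta | amax eta >= a} form a c.d.c.: if nu has maximal
   length in the support of v, then v T_(nu, rho) is a non-zero multiple
   of x_rho, so the submodule generated by v contains L_{>=bmax nu}.
   If a \in W and a < b, the span of L_{>=b} and of the x_eta - x_(eta ^
   (a, b)) with amax eta < a is a complement of L_{>=a} over L_{>=b}. If a
   \notin W and C were such a complement, write x_nu = l + c with nu =
   <(0, a)>, l in L_{>=a}, c in C; for rho = <(a, b)> the element c T_(nu,
   rho) = x_rho - l T_(nu, rho) lies in C and in L_{>=a}, hence in
   L_{>=b}. But every eta in the support of l extending nu ends with an
   entry of W, thus strictly above a, so x_rho does not occur in l T_(nu,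
   rho): a contradiction. Hence E = ~` W for this c.d.c.
   Any two c.d.c.'s of length K agree on a club, which makes the class of
   E independent of the c.d.c. *)

(** * Well-orders, clubs and c.d.c.'s *)

Section WellOrders.
Context {d : Order.disp_t} (J : orderType d).
Hypothesis wJ : well_ordered J.

Lemma well_ordered_min (P : set J) : P !=set0 ->
  exists2 x, P x & forall y, P y -> x <= y.
Proof.
move=> [x Px]; have [|z [[zP zmin] _]] := wJ (A := mem P).
  by exists x; apply: mem_set.
by exists z; [exact: set_mem | move=> y Py; apply: zmin; apply: mem_set].
Qed.

Lemma well_ordered_wf : well_founded (fun x y : J => x < y).
Proof.
move=> x; apply: contrapT => nx.
have [|z nz zmin] := @well_ordered_min [set y | ~ Acc (fun x y : J => x < y) y].
  by exists x.
apply: nz; constructor=> y yz; apply: contrapT => /zmin.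
by rewrite leNgt yz.
Qed.

Lemma exists_zero (x : J) : exists z : J, is_zero z.
Proof.
have [|z _ zmin] := @well_ordered_min setT; first by exists x.
by exists z => y; apply: zmin.
Qed.

Lemma exists_succ (x y : J) : x < y -> exists z, is_succ x z.
Proof.
move=> xy; have [|z xz zmin] := @well_ordered_min [set z | x < z].
  by exists y.
by exists z.
Qed.

Lemma zero_succ_or_limit (x : J) :
  [\/ is_zero x, exists y, is_succ y x | is_limit x].
Proof.
have [x0|x0] := pselect (is_zero x); first by constructor 1.
have [xs|xs] := pselect (exists y, is_succ y x); first by constructor 2.
by constructor 3; split=> // y yx; apply: xs; exists y.
Qed.

End WellOrders.

Lemma is_limit_lt d (J : orderType d) (x y : J) :
  is_limit x -> y < x -> exists2 z, y < z & z < x.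
Proof.
move=> [_ xl] yx; apply: contrapT => nz; apply: (xl y); split=> // z yz.
by rewrite leNgt; apply/negP => zx; apply: nz; exists z.
Qed.

(** Transfinite induction on the larger index: a c.d.c. is given as decreasing only at successor
    steps and as an infimum at limits. *)
Lemma cdc_antitone d (J : orderType d) dA (A : tbLatticeType dA) (a : J -> A) :
  well_ordered J -> is_cdc a -> forall x y, x <= y -> a y <= a x.
Proof.
move=> wJ [_ [_ alim] asucc _] x y; elim/(well_founded_ind (well_ordered_wf wJ)): y x.
move=> y IH x; rewrite le_eqVlt => /predU1P[->//|xy].
have [y0|[z zy]|yl] := zero_succ_or_limit y.
- by have := y0 x; rewrite leNgt xy.
- apply: le_trans (ltW (asucc _ _ zy)) (IH z zy.1 x _).
  by rewrite leNgt; apply/negP => zx; have := zy.2 _ zx; rewrite leNgt xy.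
- by have [lb _] := alim _ yl; apply: lb; exists x.
Qed.

(** * Regular uncountable cardinals and their clubs *)

Section RegularCardinal.
Context {d : Order.disp_t} (K : orderType d).
Hypothesis hK : regular_uncountable_cardinal K.

Let wK : well_ordered K. Proof. by case: hK. Qed.

Lemma regular_bound (x : K) (f : K -> K) :
  exists c, forall y, y < x -> f y < c.
Proof. by case: hK => _ _ + _; apply. Qed.

Lemma regular_inhabited : exists x : K, True.
Proof.
apply: contrapT => nx; case: hK => _ _ _; apply.
suff -> : [set: K] = set0 by [].
by rewrite predeqE => x; split=> // _; apply: nx; exists x.
Qed.

Lemma regular_no_max (x : K) : exists y, x < y.
Proof.
(* If something lies below [x], regularity strictly bounds the constant map [x] on a non-empty
   segment. Otherwise a maximal [x] would be the only element of [K]. *)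
have [[y yx]|nx] := pselect (exists y, y < x).
  by have [c hc] := regular_bound x (fun=> x); exists c; apply: hc yx.
apply: contrapT => nx'; case: hK => _ _ _; apply.
suff -> : [set: K] = [set x] by apply: countable1.
rewrite predeqE => y; split=> // _ /=; apply/eqP; rewrite -[_ == _]negbK neq_lt.
by apply/negP => /orP[yx|xy]; [apply: nx | apply: nx']; exists y.
Qed.

Lemma succ_fun : exists s : K -> K, forall x, is_succ x (s x).
Proof.
have /choice[s sP] : forall x : K, exists y, is_succ x y; last by exists s.
by move=> x; have [y xy] := regular_no_max x; apply: exists_succ xy.
Qed.

(** The finite ordinals [u n] are either bounded, and regularity applies to the map from [u n] to
    [t n], or they exhaust [K], which would then be countable. *)
Lemma countable_bounded (t : nat -> K) : exists c, forall n, t n < c.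
Proof.
have [s sP] := succ_fun.
have [x0 _] := regular_inhabited.
have [z z0] := exists_zero wK x0.
pose u n := iter n s z.
have u_homo : {homo u : m n / (m < n)%N >-> m < n}.
  by apply: homo_ltn lt_trans _ => n; apply: (sP _).1.
have u_inj m n : u m = u n -> m = n.
  by move=> e; case: (ltngtP m n) => // /u_homo; rewrite e ltxx.
have [[w hw]|nw] := pselect (exists w, forall n, u n < w).
  (* The bounded map inverts [u] on its range; off the range the default [0] is harmless, since any
     value may be bounded along with the rest. *)
  have [c hc] := regular_bound w (fun x => t (xget 0%N [set n | u n = x])).
  exists c => n; have := hc _ (hw n); congr (t _ < c).
  by apply: u_inj; apply: (xgetPex 0%N (P := [set m | u m = u n])); exists n.
exfalso; case: hK => _ _ _; apply.
suff -> : [set: K] = range u.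
  by apply: sub_countable (card_image_le _ _) _; apply: countableP.
rewrite predeqE => x; split=> // _.
have /cid [n xn] : exists n, x <= u n.
  apply: contrapT => nx; apply: nw; exists x => n.
  by rewrite ltNge; apply/negP => xn; apply: nx; exists n.
have /ex_minnP[m xm mmin] : exists n, x <= u n by exists n.
exists m => //; apply/eqP; rewrite eq_le xm andbT.
case: m xm mmin => [|m] xm mmin; first exact: z0.
apply: (sP _).2; rewrite ltNge; apply/negP => /mmin; by rewrite ltnn.
Qed.

(** Only limits are kept, because the value of a c.d.c. there is the infimum of its earlier
    values. *)
Definition closure_points (f : K -> K) : set K :=
  [set x | is_limit x /\ forall y, y < x -> f y < x].

Lemma club_closure_points (f : K -> K) : club (closure_points f).
Proof.
split=> [x xl xC|x].
  split=> // y /xC[z [_ zf] /andP[yz zx]].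
  exact: lt_trans (zf _ yz) zx.
(* [g] dominates [f] on all of [b <= y], so the least strict upper bound [e] of the iterates of [g]
   from [x] is a limit closed under [f]. *)
have /choice[g gP] : forall y, exists z, y < z /\ forall b, b <= y -> f b < z.
  move=> y; have [y' yy'] := regular_no_max y.
  have [c hc] := regular_bound y' f.
  exists (Order.max y' c); rewrite lt_max yy'; split=> // b bY.
  by rewrite lt_max (hc _ (le_lt_trans bY yy')) orbT.
pose t n := iter n g x.
have [c hc] := countable_bounded t.
have [|e te emin] := @well_ordered_min _ _ wK [set e | forall n, t n < e].
  by exists c.
have below b : b < e -> exists n, b <= t n.
  move=> be; apply: contrapT => nb; have : e <= b.
    by apply: emin => n; rewrite ltNge; apply/negP => bn; apply: nb; exists n.
  by rewrite leNgt be.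
exists e; last exact: (te 0%N).
split; first split.
- by move=> e0; have := e0 (t 0%N); rewrite leNgt te.
- move=> b [be bmin]; have [n bn] := below _ be.
  have := bmin (t n.+1) (le_lt_trans bn (gP _).1).
  by rewrite leNgt te.
- move=> b be; have [n bn] := below _ be.
  exact: lt_trans ((gP _).2 _ bn) (te n.+1).
Qed.

Lemma clubI (C D : set K) : club C -> club D -> club (C `&` D).
Proof.
move=> [Cc Cu] [Dc Du]; split=> [x xl xCD|x].
  split; [apply: Cc|apply: Dc] => // b bx;
  by have [c [Cx Dx] h] := xCD _ bx; exists c.
(* [f] and [g] pick later elements of [C] and [D]; a limit closed under both is approached by both
   clubs. *)
have /choice[f fP] : forall y, exists z, C z /\ y < z.
  by move=> y; have [z] := Cu y; exists z.
have /choice[g gP] : forall y, exists z, D z /\ y < z.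
  by move=> y; have [z] := Du y; exists z.
have [_ /(_ x)[e [el eP] xe]] := club_closure_points (fun y => Order.max (f y) (g y)).
have fg b : b < e -> f b < e /\ g b < e.
  by move/eP; rewrite gt_max => /andP[].
exists e => //; split; [apply: Cc|apply: Dc] => // b be.
- by exists (f b); [apply: (fP b).1 | rewrite (fP b).2 (fg _ be).1].
- by exists (g b); [apply: (gP b).1 | rewrite (gP b).2 (fg _ be).2].
Qed.

Lemma club_class_eq (C E E' : set K) :
  club C -> E `&` C = E' `&` C -> club_class E = club_class E'.
Proof.
move=> Cclub EE'.
have sub (E1 E2 : set K) : E1 `&` C = E2 `&` C -> club_class E1 `<=` club_class E2.
  move=> e D [C' C'club]; rewrite meetEset => DE.
  exists (C' `&` C); first exact: clubI.
  by rewrite !meetEset setIA DE setIAC e setIAC setIA.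
by apply/seteqP; split; apply: sub.
Qed.

(** * Comparison of c.d.c.'s, one of them of length [K] *)

Section CdcLengthK.
Context {dA : Order.disp_t} (A : tbLatticeType dA).
Implicit Types a b : K -> A.

Lemma cdc_below a (x : A) : is_cdc a -> x != \bot -> exists k, a k <= x.
Proof. by move=> [_ _ _]; apply. Qed.

Lemma cdc_refine a b : is_cdc a -> is_cdc b ->
  exists f : K -> K, forall k, a (f k) <= b k.
Proof.
move=> ca cb.
have /choice[f fP] : forall k, exists l, a l <= b k; last by exists f.
by move=> k; apply: cdc_below => //; case: cb.
Qed.

(** Below a limit closed under both refinement maps the two chains interleave, so their infima
    agree. *)
Lemma cdc_eq_on_club a b : is_cdc a -> is_cdc b ->
  exists2 C, club C & forall k, C k -> a k = b k.
Proof.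
move=> ca cb; have [f fP] := cdc_refine ca cb; have [g gP] := cdc_refine cb ca.
exists (closure_points (fun k => Order.max (f k) (g k))).
  exact: club_closure_points.
move=> k [kl kP].
have le (c e : K -> A) (h : K -> K) : is_cdc c -> is_cdc e ->
    (forall y, c (h y) <= e y) -> (forall y, y < k -> h y < k) -> c k <= e k.
  move=> cc [_ [_ /(_ _ kl)[_ elb]] _ _] hP hk; apply: elb => _ [y yk <-].
  exact: le_trans (cdc_antitone wK cc (ltW (hk _ yk))) (hP y).
apply/eqP; rewrite eq_le (le a b f) ?(le b a g) // => y /kP;
by rewrite gt_max => /andP[].
Qed.

(** Joining [z] to a complement over [y] gives one over [z]. Contrapositively, failure over [z]
    passes to every smaller [y], so it can be tested further down any other chain. *)
Lemma modular_complemented_over (x y z : A) : modular A ->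
  y <= z -> z <= x -> complemented_over x y -> complemented_over x z.
Proof.
move=> mA yz zx [c [xc xVc]]; exists (Order.join c z); split.
  by rewrite joinC meetC -mA // (meetC c) xc; apply/join_idPl.
by rewrite joinA xVc join1x.
Qed.

Lemma cdc_E_sub a b (k : K) : modular A -> is_cdc a -> is_cdc b -> a k = b k ->
  cdc_E a k -> cdc_E b k.
Proof.
move=> mA ca cb ab [l kl nl].
have [f fP] := cdc_refine cb ca.
have [m km] := regular_no_max k.
(* [m] places the index above [k], and [f l] places the value of [b] there below [a l]. *)
exists (Order.max m (f l)); first by rewrite lt_max km.
rewrite -ab => h; apply: nl; apply: modular_complemented_over h => //.
  by apply: le_trans (fP l); apply: (cdc_antitone wK cb); rewrite le_max lexx orbT.
exact: (cdc_antitone wK ca (ltW kl)).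
Qed.

Lemma club_class_cdc_E a b : modular A -> is_cdc a -> is_cdc b ->
  club_class (cdc_E a) = club_class (cdc_E b).
Proof.
move=> mA ca cb; have [C Cclub abC] := cdc_eq_on_club ca cb.
apply: (club_class_eq Cclub).
by apply/seteqP; split=> k [hE Ck]; split=> //; apply: cdc_E_sub hE => //;
  rewrite abC.
Qed.

(* K embeds in J by sending k to the least strict upper bound of the images of
   its predecessors. If these images were cofinal in J, regularity of K would
   bound all of b below by some a c, against the cofinality of b. *)
Lemma cdc_length_ge a d' (J : orderType d') (b : J -> A) : is_cdc a ->
  well_ordered J -> is_cdc b -> ordinal_le K J.
Proof.
move=> ca wJ cb; have [x0 _] := regular_inhabited.
have [j0 _] : exists j, b j <= a x0 by case: cb => _ _ _; apply; case: ca.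
pose ssup k (g : K -> J) : set J := [set j | (forall k', k' < k -> g k' < j) /\
  forall j', (forall k', k' < k -> g k' < j') -> j <= j'].
(* [f] comes from well-founded recursion. The default [j0] would occur only if earlier values had no
   strict upper bound, which [unbounded_false] excludes. *)
have [f fE] : exists f : K -> J, forall k, f k = xget j0 (ssup k f).
  pose F (k : K) (rec : forall k' : K, k' < k -> J) : J :=
    xget j0 [set j | (forall k' (h : k' < k), rec k' h < j) /\
      forall j', (forall k' (h : k' < k), rec k' h < j') -> j <= j'].
  exists (Fix (well_ordered_wf wK) (fun=> J) F) => k.
  rewrite Fix_eq // => x g g' gg'; congr F.
  by apply: functional_extensionality_dep => y; apply: funext.
have unbounded_false k : ~ forall j, exists2 k', k' < k & j <= f k'.
  move=> cof; have /choice[g gP] : forall k', exists l, a l <= b (f k').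
    by move=> k'; apply: cdc_below => //; case: cb.
  have [c cP] := regular_bound k g.
  (* Passing to the successor of [c] makes the cycle strict: [a c <= a (g k') <= b (f k') <= b j <=
     a (s c) < a c]. *)
  have [s sP] := succ_fun.
  have [j jP] : exists j, b j <= a (s c) by case: cb => _ _ _; apply; case: ca.
  have [k' k'k jk'] := cof j.
  have ac : a (s c) < a c by case: ca => _ _ + _; apply.
  suff : a c < a c by rewrite ltxx.
  apply: le_lt_trans ac; apply: le_trans jP.
  apply: le_trans (cdc_antitone wJ cb jk').
  by apply: le_trans (gP k'); apply: (cdc_antitone wK ca); apply/ltW/cP.
have fP k : ssup k f (f k).
  rewrite fE; have [|j h1 h2] := @well_ordered_min _ _ wJ
      [set j | forall k', k' < k -> f k' < j].
    apply: contrapT => nj; apply: (unbounded_false k) => j.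
    apply: contrapT => nk; apply: nj; exists j => k' k'k.
    by rewrite ltNge; apply/negP => jk'; apply: nk; exists k'.
  by apply: (xgetPex j0); exists j.
exists f => [x y xy|x y]; first exact: (fP y).1.
elim/(well_founded_ind (well_ordered_wf wK)): x => x IH.
rewrite le_eqVlt => /predU1P[->|yx]; first by exists x.
have [k kx yk] : exists2 k, k < x & y <= f k.
  apply: contrapT => nk; have : f x <= y; last by rewrite leNgt yx.
  apply: (fP x).2 => k kx.
  by rewrite ltNge; apply/negP => yk; apply: nk; exists k.
exact: IH yk.
Qed.

End CdcLengthK.
End RegularCardinal.

(** * The sequences in Y *)

Section Sequences.
Context {d : Order.disp_t} (K : orderType d) (W : set K).
Implicit Types (nu rho eta : Y W) (p : K * K).

Lemma last_le_bmax (s : @ne_seq d K) : (last s.1 s.2).2 <= bmax s.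
Proof.
case: s => p s; rewrite /bmax /=.
elim: s p => [|q s IH] p //=; rewrite le_max.
case: s IH => [|r s] IH; first by rewrite /= lexx.
by rewrite (IH p) orbT.
Qed.

Lemma amax_lt_bmax nu : amax nu < bmax nu.
Proof.
apply: lt_le_trans (last_le_bmax _); rewrite /amax.
have /and3P[/allP + _ _] := valP nu; apply; exact: mem_last.
Qed.

Lemma in_Y_single (a b : K) : a < b -> in_Y W ((a, b), [::]).
Proof. by rewrite /in_Y /= => ->. Qed.

Definition single (a b : K) (ab : a < b) : Y W := MkY (in_Y_single ab).

Lemma amax_Tstep rho p : p.1 < p.2 -> p.1 \in W ->
  amax (Tstep rho p) = Order.max (amax rho) p.1.
Proof.
move=> p12 pW; rewrite /Tstep; case: ltP => // h.
by rewrite val_insubd snoc_in_Y p12 pW h /amax /= last_rcons.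
Qed.

(** If [eta] goes beyond [nu], its last pair is not its first entry, hence is governed by [W], and
    the last [Tstep] lifts the image at least to that level. *)
Lemma Tbasis_amax nu rho eta eta' : Tbasis nu rho eta = Some eta' ->
  eta = nu /\ eta' = rho \/ amax eta \in W /\ amax eta <= amax eta'.
Proof.
rewrite /Tbasis; case: ifP => // /andP[/eqP e1 /prefixP[t et]] [<-].
rewrite et drop_size_cat //; case/lastP: t et => [|t p] et.
  left; split=> //; apply: val_inj => /=.
  move: e1 et; rewrite cats0; case: (Yval eta) (Yval nu) => [a b] [a' b'] /=.
  by move=> -> ->.
right; have -> : amax eta = p.1.
  by rewrite /amax et -rcons_cat last_rcons.
have /and3P[/= /andP[_ /allP h1] /allP h2 _] := valP eta.
have pin : p \in (Yval eta).2 by rewrite et -rcons_cat mem_rcons mem_head.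
by rewrite foldl_rcons amax_Tstep ?h1 ?h2 // le_max lexx orbT.
Qed.

Lemma amax_le_Tbasis nu rho eta eta' : bmax nu <= amax rho ->
  Tbasis nu rho eta = Some eta' -> amax eta <= amax eta'.
Proof.
move=> h /Tbasis_amax[[-> ->]|[]//].
exact: le_trans (ltW (amax_lt_bmax nu)) h.
Qed.

Section Extension.
Variables a b : K.
Hypotheses (ab : a < b) (aW : W a).

(** The default of [insubd] is reached only when [a <= amax eta]; all uses are below [a]. *)
Definition ext eta : Y W := insubd eta (snoc eta (a, b)).

Lemma ext_val eta : amax eta < a -> Yval (ext eta) = snoc eta (a, b).
Proof. by move=> h; rewrite val_insubd snoc_in_Y /= ab h mem_set. Qed.

Lemma amax_ext eta : amax eta < a -> amax (ext eta) = a.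
Proof. by move=> h; rewrite ext_val // /amax /= last_rcons. Qed.

Lemma bmax_ext eta : amax eta < a -> b <= bmax (ext eta).
Proof.
move=> h; apply: le_trans (last_le_bmax _).
by rewrite ext_val //= last_rcons.
Qed.

(** Appending [(a, b)] commutes with T until the image reaches level [a], where the pair is
    absorbed. So T sends the difference of [eta] and [ext eta] to another such difference or to
    0. *)
Lemma Tbasis_ext nu rho eta rho' : amax eta < a ->
  Tbasis nu rho eta = Some rho' ->
  Tbasis nu rho (ext eta) = Some (if amax rho' < a then ext rho' else rho').
Proof.
move=> h T1; have hi : initial_segment nu eta.
  by move: T1; rewrite /Tbasis; case: ifP.
have [rho'' -> r2] := Tbasis_snoc (ext_val h) hi T1.
congr Some; apply: val_inj; rewrite /= r2; case: ifP => // h'.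
by rewrite ext_val.
Qed.

Lemma Tbasis_ext_None nu rho eta : amax eta < a ->
  Tbasis nu rho eta = None -> nu <> ext eta -> Tbasis nu rho (ext eta) = None.
Proof.
move=> h; rewrite /Tbasis; case: ifP => // /negP hi _ ne; case: ifP => //.
rewrite /initial_segment ext_val //= => /andP[/eqP e1].
(* Either [nu] is the whole of [ext eta], which is excluded, or dropping the last pair shows that
   [nu] is already initial in [eta]. *)
move=> /prefixP[t]; case/lastP: t => [|t p]; rewrite ?cats0 => e2.
  exfalso; apply: ne; apply: val_inj; rewrite /= ext_val // /snoc -e1 e2.
  by case: (Yval nu).
exfalso; apply: hi; rewrite /initial_segment e1 eqxx /=.
by apply/prefixP; exists t; move: e2; rewrite -rcons_cat => /rcons_inj[].
Qed.

End Extension.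
End Sequences.

(** * Ideals of S as submodules of L *)

Section Modules.
Context (F : fieldType) {d : Order.disp_t} (K : orderType d) (W : set K).
Local Notation L := (L F W).
Local Notation S := (alg_S F W).
Implicit Types (nu rho eta : Y W) (u v : L).
Local Open Scope ring_scope.

Lemma x_coeff eta eta' : (x_ F eta)@_eta' = (eta == eta')%:R.
Proof. exact: mcoeffU. Qed.

Lemma L_expand v : v = \sum_(eta <- msupp v) v@_eta *: x_ F eta.
Proof.
rewrite [LHS]monalgE; apply: eq_bigr => eta _.
by apply/malgP => eta'; rewrite mcoeffU mcoeffZ x_coeff mulr_natr.
Qed.

Lemma rappB (r : rend L) u v : rapp (u - v) r = rapp u r - rapp v r.
Proof. exact: (raddfB (r : {linear L -> L})). Qed.

Lemma rapp_xB (r : rend L) (g : Y W -> L) :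
  (forall eta, rapp (x_ F eta) r = g eta) ->
  forall eta eta', rapp (x_ F eta - x_ F eta') r = g eta - g eta'.
Proof.
move=> rg eta eta'; rewrite rappB.
exact: (congr2 (fun s t => s - t) (rg eta) (rg eta')).
Qed.

Definition subspace (P : set L) :=
  P 0 /\ forall (c : F) u v, P u -> P v -> P (c *: u + v).

Lemma subspaceZ P (c : F) u : subspace P -> P u -> P (c *: u).
Proof. by move=> [P0 PZ] Pu; rewrite -[_ *: _]addr0; apply: PZ. Qed.

Lemma subspaceD P u v : subspace P -> P u -> P v -> P (u + v).
Proof. by move=> [_ PZ] Pu Pv; rewrite -[u]scale1r; apply: PZ. Qed.

Lemma subspaceB P u v : subspace P -> P u -> P v -> P (u - v).
Proof. by move=> [_ PZ] Pu Pv; rewrite addrC -scaleN1r; apply: PZ. Qed.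

Lemma subspace_rapp P (f : rend L) v : subspace P ->
  (forall eta, eta \in msupp v -> P (rapp (x_ F eta) f)) -> P (rapp v f).
Proof.
move=> hP Pf; rewrite [v in rapp v _]L_expand /rapp linear_sum big_seq.
apply: big_ind => [|x y|eta /Pf]; [exact: hP.1|exact: subspaceD|].
by rewrite linearZ; exact: subspaceZ.
Qed.

Definition supp_in (Q : Y W -> Prop) : set L :=
  [set v | forall eta, eta \in msupp v -> Q eta].

Lemma supp_in_x Q eta : Q eta -> supp_in Q (x_ F eta).
Proof. by move=> Qe eta' /(fsubsetP msuppU_le); rewrite inE => /eqP ->. Qed.

Lemma supp_in_subspace Q : subspace (supp_in Q).
Proof.
split=> [eta|c u v Qu Qv eta]; first by rewrite msupp0.
move/(fsubsetP (msuppD_le _ _)); rewrite in_fsetU => /orP[|/Qv//].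
by move/(fsubsetP (msuppZ_le _ _))/Qu.
Qed.

Lemma supp_in_T (Q Q' : Y W -> Prop) nu rho v :
  (forall eta eta', Q eta -> Tbasis nu rho eta = Some eta' -> Q' eta') ->
  supp_in Q v -> supp_in Q' (rapp v (T F nu rho)).
Proof.
move=> QQ' Qv; apply: subspace_rapp => [|eta /Qv Qe]; first exact: supp_in_subspace.
rewrite T_basis; case E : (Tbasis nu rho eta) => [eta'|] /=.
  by apply: supp_in_x; apply: QQ' E.
exact: (supp_in_subspace _).1.
Qed.

Record submodule (P : set L) : Prop := Submodule {
  submodule_subspace : subspace P;
  submodule_T : forall nu rho v, (bmax nu <= amax rho)%O -> P v ->
    P (rapp v (T F nu rho)) }.

(** The endomorphisms preserving [P] form a unital subalgebra containing the generators of R. *)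
Lemma submodule_alg_R P r v : submodule P -> alg_R F W r -> P v -> P (rapp v r).
Proof.
move=> [hP PT] Rr; move: v.
apply: (Rr [set r | forall v, P v -> P (rapp v r)]); split=> [|_ [nu [rho [h ->]]]].
  split=> [v|c f g hf hg v Pv|f g hf hg v Pv]; first by rewrite rapp1.
    by rewrite rappD rappZ; apply: hP.2; [apply: hf|apply: hg].
  by rewrite rappM; apply/hg/hf.
by move=> v; apply: PT.
Qed.

Lemma Sval_inj : injective (@Sval F d K W).
Proof. exact: val_inj. Qed.

Lemma in_S_upper (c : F) v : in_S F W (Trimx c v 0).
Proof.
apply: mem_set => P [[P1 PZ _] _] /=.
(* The zero of R is obtained as [-1 *: 1 + 1]. *)
by have := PZ (-1) 1 1 P1 P1; rewrite scaleN1r addNr.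
Qed.

Definition upper (c : F) v : S := MkS (in_S_upper c v).

Definition ideal_of_set (P : set L) : set S :=
  [set m | exists2 v, P v & Sval m = Trimx 0 v 0].

(** On the upper right corner, left multiplication acts by the scalar [tri_f] and right
    multiplication by an element of R. *)
Lemma ideal_of_setP P : submodule P -> two_sided_ideal (ideal_of_set P).
Proof.
move=> hP; have [sP _] := hP; split; first by exists 0 => //; exact: sP.1.
- move=> m n [u Pu hu] [v Pv hv]; exists (u - v); first exact: subspaceB.
  by rewrite SvalB hu hv; congr Trimx; apply: subr0.
- move=> m n [u Pu hu]; exists (tri_f (Sval m) *: u); first exact: subspaceZ.
  by rewrite SvalM hu; congr Trimx => /=; rewrite ?mulr0 ?rapp0 ?addr0.
- move=> n m [u Pu hu]; exists (rapp u (tri_r (Sval m))).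
    by apply: submodule_alg_R => //; apply: set_mem; exact: (valP m).
  by rewrite SvalM hu; congr Trimx => /=; rewrite ?mul0r ?scale0r ?add0r.
Qed.

Lemma ideal_of_leI P (hP : submodule P) :
  (Ideal (ideal_of_setP hP) <= Ideal (S_ideal_IP F W))%O.
Proof. by apply/ideal_leP => m [v _ hv]; exists v. Qed.

Definition ideal_of P (hP : submodule P) : lattice_A F W :=
  Downset (ideal_of_leI hP).

Implicit Types I J : lattice_A F W.

Definition submod I : set L := [set v | ideal_set (downset_val I) (upper 0 v)].

Lemma submod_submodule I : submodule (submod I).
Proof.
split=> [|nu rho v h Iv].
  split=> [|c u v Iu Iv]; rewrite /submod /=.
    suff -> : upper 0 0 = 0 by apply: ideal0.
    exact: val_inj.
  (* Scalars are realised as left multiplication by [upper c 0]. *)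
  suff -> : upper 0 (c *: u + v) = upper c 0 * upper 0 u + upper 0 v.
    by apply: idealD => //; apply: idealMl.
  apply: Sval_inj; rewrite SvalD SvalM /=; congr Trimx => /=.
  - by rewrite mulr0 addr0.
  - by rewrite rapp0 addr0.
  - by rewrite mulr0 addr0.
have RT : in_S F W (Trimx 0 0 (T F nu rho)).
  by apply: mem_set => P [_]; apply; exists nu, rho.
rewrite /submod /=; suff -> : upper 0 (rapp v (T F nu rho)) = upper 0 v * MkS RT.
  exact: (Defs.idealMr (MkS RT) Iv).
apply: Sval_inj; rewrite SvalM /=; congr Trimx => /=.
- by rewrite mulr0.
- by rewrite scaler0 add0r.
- by rewrite mul0r.
Qed.

Lemma submod_ideal_of P (hP : submodule P) : submod (ideal_of hP) = P.
Proof.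
apply/seteqP; split=> [v [u Pu [->]]//|v Pv]; by exists v.
Qed.

(** Every element of an ideal inside I has the form [upper 0 v], so the ideal is determined by its
    corner entries. *)
Lemma submod_le I J : (I <= J)%O <-> submod I `<=` submod J.
Proof.
split=> [/ideal_leP IJ v|IJ]; first exact: IJ.
apply/ideal_leP => m Im; have /ideal_leP/(_ _ Im)[v mE] := valP I.
have mU : m = upper 0 v by apply: val_inj.
by move: Im; rewrite mU; exact: IJ.
Qed.

Lemma submod_inj I J : submod I = submod J -> I = J.
Proof.
by move=> IJ; apply/eqP; rewrite eq_le; apply/andP; split; apply/submod_le;
  rewrite IJ.
Qed.

Lemma submod_bot : submod \bot%O = [set 0].
Proof.
apply/seteqP; split=> v /=; first by move/(congr1 (@Sval F d K W)) => -[].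
by move=> ->; apply: Sval_inj.
Qed.

Lemma submod_top : submod \top%O = setT.
Proof. by apply/seteqP; split=> v // _; exists v. Qed.

Lemma submod_meet I J : submod (Order.meet I J) = submod I `&` submod J.
Proof. by []. Qed.

Lemma submod_join I J v : submod (Order.join I J) v <->
  exists u w, [/\ submod I u, submod J w & v = u + w].
Proof.
split=> [[m [n [Im Jn mn]]]|[u [w [Iu Jw ->]]]].
  have /ideal_leP/(_ _ Im)[u mE] := valP I.
  have /ideal_leP/(_ _ Jn)[w nE] := valP J.
  have mU : m = upper 0 u by apply: val_inj.
  have nU : n = upper 0 w by apply: val_inj.
  exists u, w; rewrite /submod /= -mU -nU; split=> //.
  by move: mn => /(congr1 (@Sval F d K W)); rewrite SvalD mE nE => -[].
exists (upper 0 u), (upper 0 w); split=> //; apply: Sval_inj.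
by rewrite SvalD; congr Trimx; rewrite addr0.
Qed.

Lemma modular_lattice_A : modular (lattice_A F W).
Proof.
move=> I J M /submod_le IM; apply: submod_inj; apply/seteqP; split=> v.
  move/submod_join => [u [w [Iu [Jw Mw] ->]]]; split.
    by apply/submod_join; exists u, w.
  by apply: (subspaceD (submodule_subspace (submod_submodule M))) => //; apply: IM.
move=> [/submod_join[u [w [Iu Jw vE]]] Mv]; apply/submod_join.
exists u, w; split=> //; split=> //.
have -> : w = v - u by rewrite vE addrC addKr.
by apply: (subspaceB (submodule_subspace (submod_submodule M))) => //; apply: IM.
Qed.

End Modules.

(** * The chain of tails *)

Section LinearExtension.
Context (F : fieldType) {d : Order.disp_t} (K : orderType d) (W : set K).
Local Notation L := (L F W).
Variable g : Y W -> L.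
Implicit Types (u v : L).
Local Open Scope ring_scope.

Definition lin_ext v : L := \sum_(eta <- msupp v) v@_eta *: g eta.

Lemma lin_extEw v (D : {fset Y W}) : (msupp v `<=` D)%fset ->
  lin_ext v = \sum_(eta <- D) v@_eta *: g eta.
Proof.
move=> sD; apply: big_fset_incl => // eta _ h.
by rewrite mcoeff_outdom // scale0r.
Qed.

Lemma lin_ext_linear : linear lin_ext.
Proof.
move=> c u v.
pose D := (msupp u `|` msupp v `|` msupp (c *: u + v))%fset.
rewrite (@lin_extEw u D) 1?(@lin_extEw v D) 1?(@lin_extEw (c *: u + v) D).
- rewrite scaler_sumr -big_split /=; apply: eq_bigr => eta _.
  by rewrite mcoeffD mcoeffZ scalerDl scalerA.
- exact: fsubsetUr.
- by apply: fsubset_trans (fsubsetUl _ _); apply: fsubsetUr.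
- by apply: fsubset_trans (fsubsetUl _ _); apply: fsubsetUl.
Qed.

HB.instance Definition _ :=
  GRing.isLinear.Build F L L *:%R lin_ext lin_ext_linear.

Lemma lin_ext_x eta : lin_ext (x_ F eta) = g eta.
Proof.
rewrite (@lin_extEw _ [fset eta]%fset) ?msuppU_le //.
by rewrite big_seq_fset1 mcoeffUU scale1r.
Qed.

Lemma exists_rend_on_basis : exists f : rend L, forall eta, rapp (x_ F eta) f = g eta.
Proof. by exists (lin_ext : {linear L -> L}) => eta; exact: lin_ext_x. Qed.

End LinearExtension.

Section Tails.
Context (F : fieldType) {d : Order.disp_t} (K : orderType d) (W : set K).
Local Notation L := (L F W).
Implicit Types (nu rho eta : Y W) (u v : L) (I J : lattice_A F W).

Definition tail (a : K) : set L := supp_in (fun eta => a <= amax eta).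

Lemma tail_submodule a : submodule (tail a).
Proof.
split=> [|nu rho v h]; first exact: supp_in_subspace.
apply: supp_in_T => eta eta' ae /(amax_le_Tbasis h); exact: le_trans.
Qed.

Lemma tail_subspace a : subspace (tail a).
Proof. exact: supp_in_subspace. Qed.

Lemma tail_le a b : a <= b -> tail b `<=` tail a.
Proof. by move=> ab v vb eta /vb; apply: le_trans. Qed.

Definition tail_ideal a : lattice_A F W := ideal_of (tail_submodule a).

Lemma submod_tail a : submod (tail_ideal a) = tail a.
Proof. exact: submod_ideal_of. Qed.

Lemma x_neq0 eta : x_ F eta <> 0%R.
Proof.
move/(congr1 (fun v : L => v@_eta)%R); rewrite x_coeff eqxx mcoeff0 => /eqP.
by rewrite oner_eq0.
Qed.

Lemma tail_x a eta : tail a (x_ F eta) <-> a <= amax eta.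
Proof.
split; last exact: supp_in_x.
by apply; rewrite -mcoeff_neq0 x_coeff eqxx oner_neq0.
Qed.

Local Open Scope ring_scope.

Lemma submodule_tail (P : set L) v : submodule P -> P v -> v <> 0 ->
  exists a, tail a `<=` P.
Proof.
move=> hP Pv v0.
have [nu0 nu0v] : exists eta, eta \in msupp v.
  apply: contrapT => nv; apply: v0; apply/malgP => eta.
  by rewrite mcoeff0 mcoeff_outdom //; apply/negP => ev; apply: nv; exists eta.
(* [n] is the largest size in the support; sizes count the entries after the first. *)
have [n nP nmax] : exists2 n, (exists2 nu, nu \in msupp v & size (Yval nu).2 = n)
    & forall eta, eta \in msupp v -> (size (Yval eta).2 <= n)%N.
  pose s := [seq size (Yval eta).2 | eta <- msupp v].
  have s0 : size (Yval nu0).2 \in s by apply: map_f.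
  exists (\max_(k <- s) k)%N; last first.
    by move=> eta ev; apply: leq_bigmax_seq => //; apply: map_f.
  have : (\max_(k <- s) k)%N \in s.
    move: s s0 => s; case: s => // k s _; elim: s k => [|l s IH] k.
      by rewrite big_seq1 mem_head.
    rewrite big_cons; case: leqP => [_|_]; first by rewrite inE IH orbT.
    by rewrite mem_head.
  by move=> /mapP[nu nuv ->]; exists nu.
move: nP => [nu nuv nun].
(* Only [nu] contributes: another [eta] in the support extending it would have size above [n]. *)
have vT rho : rapp v (T F nu rho) = v@_nu *: x_ F rho.
  rewrite /rapp /= /Tfun (bigD1_seq nu) ?fset_uniq //= Tbasis_self /=.
  rewrite big_seq_cond big1 ?addr0 // => eta /andP[ev en].
  suff /negP h : ~ initial_segment nu eta by rewrite Tbasis_not_initial // scaler0.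
  move=> /andP[/eqP e1 /prefixP[t e2]].
  have := nmax _ ev; rewrite e2 size_cat nun -[X in (_ <= X)%N]addn0 leq_add2l.
  rewrite leqn0 size_eq0 => /eqP t0; move/eqP: en; apply.
  move: e1 e2; rewrite t0 cats0 => e1 e2; apply: val_inj => /=.
  by case: (Yval eta) (Yval nu) e1 e2 => [? ?] [? ?] /= -> ->.
exists (bmax nu) => w wt; rewrite (L_expand w) big_seq.
have [sP _] := hP.
apply: big_ind => [|x y|eta /wt h]; [exact: sP.1|exact: subspaceD|].
apply: subspaceZ => //; have := submodule_T hP h Pv; rewrite vT.
move/(subspaceZ (v@_nu)^-1 sP); rewrite scalerA mulVf ?scale1r //.
by rewrite mcoeff_neq0.
Qed.

End Tails.

(** * Complements of one tail over another *)

Section Complements.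
Context (F : fieldType) {d : Order.disp_t} (K : orderType d) (W : set K).
Local Notation L := (L F W).
Implicit Types (nu rho eta : Y W) (u v : L).

Section Complemented.
Variables a b : K.
Hypotheses (ab : (a < b)%O) (aW : W a).
Local Open Scope ring_scope.

(** The basis values of a projection [phi] with kernel [tail a]: it kills [ext a b eta], whose
    [amax] is exactly [a], and therefore fixes the differences. *)
Definition diff_ext eta : L :=
  if (amax eta < a)%O then x_ F eta - x_ F (ext a b eta) else 0.

Lemma diff_ext_lt eta : (amax eta < a)%O ->
  diff_ext eta = x_ F eta - x_ F (ext a b eta).
Proof. by rewrite /diff_ext => ->. Qed.

Lemma diff_ext_ge eta : ~~ (amax eta < a)%O -> diff_ext eta = 0.
Proof. by rewrite /diff_ext => /negbTE ->. Qed.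

Variable phi : rend L.
Hypothesis phi_x : forall eta, rapp (x_ F eta) phi = diff_ext eta.

Lemma phi_tail v : tail a v -> rapp v phi = 0.
Proof.
move=> va; apply: (@subspace_rapp _ _ _ _ [set 0]) => [|eta /va h] /=.
  by split=> // c x y -> ->; rewrite scaler0 addr0.
by rewrite phi_x diff_ext_ge // -leNgt.
Qed.

Lemma phi_diff_ext eta : rapp (diff_ext eta) phi = diff_ext eta.
Proof.
case: (boolP (amax eta < a)%O) => h; last by rewrite diff_ext_ge // rapp0l.
rewrite {1}(diff_ext_lt h) (rapp_xB phi_x).
by rewrite (@diff_ext_ge (ext a b eta)) ?subr0 // (amax_ext ab aW h) ltxx.
Qed.

Lemma phi_idem v : rapp (rapp v phi) phi = rapp v phi.
Proof.
apply: (@subspace_rapp _ _ _ _ [set u | rapp u phi = u]) => [|eta _] /=.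
  split=> [|c x y xE yE] /=; first by rewrite rapp0l.
  by rewrite rapp_addl rapp_scalel xE yE.
by rewrite phi_x phi_diff_ext.
Qed.

(** This is [tail b] plus the image of [phi], written as a congruence modulo [tail b] so that no
    decomposition has to be chosen. *)
Definition compl_set : set L := [set v | tail b (v - rapp v phi)].

Lemma compl_subspace : subspace compl_set.
Proof.
split=> [|c u v hu hv]; rewrite /compl_set /=.
  by rewrite rapp0l subrr; exact: (tail_subspace F W _).1.
rewrite rapp_addl rapp_scalel opprD addrACA -scalerBr.
exact: (tail_subspace F W b).2.
Qed.

Lemma tail_compl_set : tail b `<=` compl_set.
Proof.
move=> v vb; rewrite /compl_set /= phi_tail ?subr0 //.
by apply: tail_le vb; exact: ltW.
Qed.

Lemma diff_ext_compl_set eta : compl_set (diff_ext eta).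
Proof.
by rewrite /compl_set /= phi_diff_ext subrr; exact: (tail_subspace F W _).1.
Qed.

Lemma compl_submodule : submodule compl_set.
Proof.
split=> [|nu rho v h vC]; first exact: compl_subspace.
(* Split [v] into [v - rapp v phi], which lies in the submodule [tail b], and [rapp v phi], which
   can be treated one difference at a time. *)
rewrite -(subrK (rapp v phi) v) rapp_addl; apply: (subspaceD compl_subspace).
  by apply: tail_compl_set; exact: (submodule_T (tail_submodule F W b) h vC).
rewrite -rappM; apply: (subspace_rapp compl_subspace) => eta _; rewrite rappM phi_x.
have [ea|ea] := boolP (amax eta < a)%O; last first.
  by rewrite diff_ext_ge // rapp0l; exact: compl_subspace.1.
rewrite (diff_ext_lt ea) (rapp_xB (T_basis F nu rho)).
case E : (Tbasis nu rho eta) => [rho'|] /=.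
  rewrite (Tbasis_ext ab aW ea E) /=; have := @diff_ext_compl_set rho'.
  rewrite /diff_ext; case: ifP => // _ _.
  by rewrite subrr; exact: compl_subspace.1.
have [ne|ne] := pselect (nu = ext a b eta); last first.
  by rewrite (Tbasis_ext_None ab aW ea E ne) subrr; exact: compl_subspace.1.
(* For [nu] equal to [ext a b eta] only [x_rho] survives; it lies in [tail b] because
   [b <= bmax nu <= amax rho]. *)
rewrite ne Tbasis_self /=; apply: (subspaceB compl_subspace).
  exact: compl_subspace.1.
apply/tail_compl_set/tail_x; apply: le_trans h.
by rewrite ne; exact: bmax_ext.
Qed.

Lemma sub_phi_tail v : tail a (v - rapp v phi).
Proof.
have -> : v - rapp v phi = rapp v (1 - phi) by [].
apply: (subspace_rapp (tail_subspace F W a)) => eta _.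
rewrite -[rapp _ _]/(x_ F eta - rapp (x_ F eta) phi) phi_x.
have [h|h] := boolP (amax eta < a)%O.
  by rewrite diff_ext_lt // opprB addrC subrK tail_x (amax_ext ab aW h).
by rewrite diff_ext_ge // subr0 tail_x leNgt.
Qed.

End Complemented.

Lemma tail_complemented (a b : K) : a < b -> W a ->
  complemented_over (tail_ideal F W a) (tail_ideal F W b).
Proof.
move=> ab aW; have [phi phi_x] := exists_rend_on_basis (diff_ext a b).
exists (ideal_of (compl_submodule ab aW phi_x)); split; apply: submod_inj.
  rewrite submod_meet !submod_tail submod_ideal_of.
  (* On [tail a] the map [phi] vanishes, so the congruence defining [compl_set] reduces to
     membership in [tail b]. *)
  apply/seteqP; split=> [v [va]|v vb].
    by rewrite /compl_set /= (phi_tail phi_x) // subr0.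
  by split; [apply: tail_le vb; exact: ltW|exact: (tail_compl_set ab phi_x)].
rewrite submod_top; apply/seteqP; split=> v // _; apply/submod_join.
exists (v - rapp v phi)%R, (rapp v phi).
rewrite submod_tail submod_ideal_of subrK; split=> //.
  exact: (sub_phi_tail ab aW phi_x).
rewrite /compl_set /= (phi_idem ab aW phi_x) subrr.
exact: (tail_subspace F W _).1.
Qed.

Lemma tail_not_complemented (z a b : K) : (z < a)%O -> (a < b)%O -> ~ W a ->
  ~ complemented_over (tail_ideal F W a) (tail_ideal F W b).
Proof.
move=> za ab aW [c [acb aVc]].
(* Both are in Y although [a] is outside [W], first entries being unconstrained. Any [z] below [a]
   can replace 0, and [bmax nu] and [amax rho] both equal [a]. *)
pose nu := single W za; pose rho := single W ab.
have : submod \top%O (x_ F nu) by rewrite submod_top.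
rewrite -aVc => /submod_join[l [w [la wc nuE]]].
rewrite submod_tail in la.
have h : (bmax nu <= amax rho)%O by rewrite /bmax /amax /=.
have cM := submod_submodule c.
have wT : submod c (rapp w (T F nu rho)) by exact: (submodule_T cM).
(* The case [eta = nu] is impossible, since [amax nu] is [z]. Otherwise [amax eta] is in [W] and at
   least [a], hence strictly above [a]. *)
have lT : supp_in (fun eta => (a < amax eta)%O) (rapp l (T F nu rho)).
  apply: supp_in_T la => eta eta' ae /Tbasis_amax[[en _]|[eW ee']].
    by move: ae; rewrite en leNgt /amax /= za.
  rewrite (lt_le_trans _ ee') // lt_neqAle ae andbT; apply/eqP => ea.
  by apply: aW; rewrite ea; exact: set_mem.
have wTE : rapp w (T F nu rho) = (x_ F rho - rapp l (T F nu rho))%R.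
  have := T_basis F nu rho nu; rewrite Tbasis_self /= nuE rapp_addl => <-.
  by rewrite addrC addKr.
have : submod (tail_ideal F W b) (rapp w (T F nu rho)).
  rewrite -acb submod_meet; split=> //; rewrite submod_tail wTE.
  apply: (subspaceB (tail_subspace F W _)); first exact/tail_x.
  by move=> eta /lT/ltW.
rewrite submod_tail => /(_ rho).
have rho_lT : (rapp l (T F nu rho))@_rho%R = 0%R.
  by apply: mcoeff_outdom; apply/negP => /lT; rewrite ltxx.
rewrite -mcoeff_neq0 wTE mcoeffB x_coeff rho_lT eqxx subr0 oner_neq0.
by move=> /(_ isT); rewrite leNgt ab.
Qed.

End Complements.

(** * The tails form a c.d.c., and its set E *)

Section TailCdc.
Context (F : fieldType) {d : Order.disp_t} (K : orderType d) (W : set K).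
Hypothesis no_max : forall x : K, exists y, x < y.

Lemma tail_ideal_cdc : is_cdc (tail_ideal F W).
Proof.
have single_at a : exists eta : Y W, amax eta = a.
  by have [b ab] := no_max a; exists (single W ab).
split.
- move=> a; have [eta ea] := single_at a.
  apply/eqP => /(congr1 (@submod F d K W)); rewrite submod_tail submod_bot => e.
  by apply: (@x_neq0 F _ _ W eta); have := (tail_x F a eta).2; rewrite ea lexx e => ->.
- split=> [a a0|a al].
    apply: submod_inj; rewrite submod_tail submod_top.
    by apply/seteqP; split=> v // _ eta _; apply: a0.
  split=> [_ [b ba <-]|I lbI].
    by apply/submod_le; rewrite !submod_tail; apply/tail_le/ltW.
  apply/submod_le => v Iv; rewrite submod_tail => eta ev.
  (* If [amax eta] were below the limit [a], some [b] would lie strictly between them, and [I] would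
     not be contained in the tail at [b]. *)
  rewrite leNgt; apply/negP => /(is_limit_lt al)[b eb ba].
  have /submod_le/(_ _ Iv) : I <= tail_ideal F W b by apply: lbI; exists b.
  by rewrite submod_tail => /(_ _ ev); rewrite leNgt eb.
- move=> a b [ab _]; rewrite lt_leAnge; apply/andP; split.
    by apply/submod_le; rewrite !submod_tail; apply/tail_le/ltW.
  apply/negP => /submod_le; rewrite !submod_tail => sub.
  have [eta ea] := single_at a.
  have /tail_x : tail b (x_ F eta) by apply/sub/tail_x; rewrite ea.
  by rewrite ea leNgt ab.
- move=> I I0.
  have [v Iv v0] : exists2 v, submod I v & v <> 0%R.
    apply: contrapT => nv; case/eqP: I0; apply: submod_inj; rewrite submod_bot.
    apply/seteqP; split=> v /=; last by move=> ->; case: (submod_submodule I) => -[].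
    by move=> Iv; apply: contrapT => v0; apply: nv; exists v.
  have [a aI] := submodule_tail (submod_submodule I) Iv v0.
  by exists a; apply/submod_le; rewrite submod_tail.
Qed.

Lemma cdc_E_tail_ideal : (forall z : K, is_zero z -> W z) ->
  cdc_E (tail_ideal F W) = ~` W.
Proof.
move=> W0; apply/seteqP; split=> a.
  by move=> [b ab nab] aW; apply/nab/tail_complemented.
move=> aW; have [b ab] := no_max a; exists b => //.
(* Zero belongs to [W], so [a] is not zero. *)
have [z za] : exists z, z < a.
  apply: contrapT => nz; apply/aW/W0 => z.
  by rewrite leNgt; apply/negP => za; apply: nz; exists z.
exact: tail_not_complemented za ab aW.
Qed.

End TailCdc.

Theorem corollary3p1 (F : fieldType) (d : Order.disp_t) (K : orderType d)
    (hK : regular_uncountable_cardinal K)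
    (i : set (set K)) (hi : club_algebra i)
    (W : set K) (hW0 : forall z : K, is_zero z -> W z)
    (hWi : club_class (~` W)%classic = i) :
  GRing.subalg_closed (in_S F W) /\
  two_sided_ideal (S_ideal_I F W) /\
  modular (lattice_A F W) /\
  strongly_dense (lattice_A F W) /\
  has_dimension (lattice_A F W) K /\
  is_Gamma (lattice_A F W) i.
Proof.
have cdcU := @tail_ideal_cdc F d K W (regular_no_max hK).
have cdcA : exists a : K -> lattice_A F W, is_cdc a by exists (tail_ideal F W).
have modA := @modular_lattice_A F d K W.
split; first exact: in_S_closed.
split; first exact: S_ideal_IP.
split=> //; split; first by exists d, K; split=> //; case: hK.
split.
  by split=> // d' J wJ [b cb]; exact: (cdc_length_ge hK cdcU wJ cb).
split=> // a ca; rewrite (club_class_cdc_E hK modA ca cdcU).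
by rewrite (cdc_E_tail_ideal F (regular_no_max hK) hW0).
Qed.
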